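(* Let $G$ be a cubic Hamiltonian-transitive graph. Then its truncation $\operatorname{T}(G)$ is Hamiltonian-transitive.
   Context: All graphs are finite, simple and undirected. Cubic means 3-regular. A Hamiltonian cycle is a cycle (of length at least 3) through all vertices, identified with its edge set. A graph is Hamiltonian-transitive if it has a Hamiltonian cycle and for every pair of Hamiltonian cycles there is an automorphism of the graph mapping one to the other. The truncation $\operatorname{T}(G)$ of a cubic graph $G$ is the cubic graph obtained by replacing each vertex by a triangle: its vertices are $v_x$ for all ordered pairs $(v,x)$ with $\{v,x\}\in E(G)$; for each vertex $v$ of $G$ with neighbors $x,y,z$ the vertices $v_x,v_y,v_z$ are pairwise adjacent, and for each edge $\{u,v\}\in E(G)$ the vertices $u_v$ and $v_u$ are adjacent; there are no other edges. *)

(* Defs.v *)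
From mathcomp Require Import all_boot perm.
Set Implicit Arguments.
Unset Strict Implicit.
Unset Printing Implicit Defensive.

Record sgraph := SGraph {
  vertex :> finType;
  adj : rel vertex;
  adj_sym : symmetric adj;
  adj_irrefl : irreflexive adj }.

Definition cubic (G : sgraph) : Prop :=
  forall v : G, #|[set x | adj v x]| = 3.

(* [s] lists the vertices in cyclic order: [next s] wraps around. *)
Definition cycle_edges (T : finType) (s : seq T) : {set {set T}} :=
  [set [set x; next s x] | x in s].

(* The size condition is not redundant: [cycle] accepts sequences of size 2
   that traverse a single edge back and forth. *)
Definition hamiltonian_cycle (G : sgraph) (C : {set {set G}}) : Prop :=
  exists s : seq G,
    [/\ cycle (@adj G) s, uniq s, 2 < size s, forall v : G, v \in s
      & C = cycle_edges s].

Definition automorphism (G : sgraph) (f : {perm G}) : Prop :=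
  forall x y : G, adj (f x) (f y) = adj x y.

Definition map_edges (T : finType) (f : {perm T}) (C : {set {set T}}) :
    {set {set T}} :=
  [set f @: E | E : {set T} in C].

Definition hamiltonian_transitive (G : sgraph) : Prop :=
  (exists C : {set {set G}}, hamiltonian_cycle C) /\
  (forall C D : {set {set G}}, hamiltonian_cycle C -> hamiltonian_cycle D ->
     exists2 f : {perm G}, automorphism f & map_edges f C = D).

Section Truncation.
Variable G : sgraph.

(* The pair (v, x) stands for the vertex v_x. *)
Definition trunc_vertex : finType := {p : G * G | adj p.1 p.2}.

(* Either v_x and v_y with x != y, or u_v and v_u. *)
Definition trunc_adj : rel trunc_vertex := fun p q =>
  let: (v, x) := val p in
  let: (w, y) := val q in
  (v == w) && (x != y) || (v == y) && (x == w).

Lemma trunc_adj_sym : symmetric trunc_adj.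
Proof.
move=> [[v x] vx] [[w y] wy]; rewrite /trunc_adj /=.
by rewrite (eq_sym w v) (eq_sym y x) (eq_sym w x) (eq_sym y v) [in RHS](andbC (x == w)).
Qed.

Lemma trunc_adj_irrefl : irreflexive trunc_adj.
Proof.
move=> [[v x] /= vx]; rewrite /trunc_adj /= !eqxx /=.
by apply/negP=> /andP[/eqP vEx _]; rewrite vEx adj_irrefl in vx.
Qed.

Definition truncation : sgraph := SGraph trunc_adj_sym trunc_adj_irrefl.

End Truncation.

(* Main.v *)
(* A Hamiltonian cycle D of T(G) meets every triangle in a path: D is connected,
   so it leaves each triangle, and it cannot leave a three-vertex triangle twice.
   Contracting the triangles turns D into a Hamiltonian cycle C of G, and D is
   recovered from C by a rule (lift_edges) that automorphisms of G respect.  So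
   an automorphism of G mapping C to C' induces one of T(G) mapping D to D'. *)

Require Import Defs.
From mathcomp Require Import all_boot perm.
Set Implicit Arguments.
Unset Strict Implicit.
Unset Printing Implicit Defensive.

(** * Hamiltonian cycles as successor maps with a single orbit *)

Lemma hamiltonian_cycle_perm (G : sgraph) (C : {set {set G}}) :
    hamiltonian_cycle C ->
  exists s : {perm G}, [/\ 2 < #|G|, forall v, adj v (s v),
    forall v w, fconnect s v w & C = [set [set v; s v] | v : G]].
Proof.
case=> s [cyc_s uniq_s size_s mem_s ->].
have next_inj : injective (next s) := can_inj (prev_next uniq_s).
exists (perm next_inj); split.
- by rewrite (leq_trans size_s) // -(card_uniqP uniq_s) max_card.
- by move=> v; rewrite permE; apply: next_cycle.
- move=> v w; rewrite (eq_fconnect (permE next_inj)).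
  by rewrite (fconnect_cycle (cycle_next uniq_s) (mem_s v)) mem_s.
- apply/setP=> E; apply/imsetP/imsetP => -[v _ ->]; exists v => //.
    by rewrite permE.
  by rewrite permE.
Qed.

(** Connectivity alone makes [s] bijective: every [w] is reached from [s w], so [s] is surjective on
    a finite set. The orbit of any vertex is then the required cyclic list. *)
Lemma hamiltonian_cycle_fun (G : sgraph) (s : G -> G) :
    2 < #|G| -> (forall v, adj v (s v)) -> (forall v w, fconnect s v w) ->
  hamiltonian_cycle [set [set v; s v] | v : G].
Proof.
move=> cardG adj_s conn_s.
have s_surj w : exists v, s v = w.
  have /iter_findex := conn_s (s w) w.
  case: (findex s (s w) w) => [|n] /= eq_w; last by exists (iter n s (s w)).
  by exists w.
have [t st] := fin_all_exists s_surj.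
have s_inj : injective s.
  have [u us su] : bijective t := injF_bij (can_inj st).
  by move=> x y; rewrite -[x]su -[y]su !st => ->.
have [v0 _] : exists v0 : G, v0 \in G by apply/card_gt0P; apply: leq_trans cardG.
have mem_orb v : v \in orbit s v0 by rewrite -fconnect_orbit.
have cyc_orb := cycle_orbit s_inj v0.
exists (orbit s v0); split=> //.
- by apply: sub_cycle cyc_orb => x y /eqP <-.
- by rewrite -(card_uniqP (orbit_uniq s v0)) (eq_card (B := G)) // => v; rewrite mem_orb.
- apply/setP=> E; apply/imsetP/imsetP=> -[v _ ->]; exists v => //.
    by have /eqP <- := next_cycle cyc_orb (mem_orb v).
  by have /eqP <- := next_cycle cyc_orb (mem_orb v).
Qed.

(** Otherwise the orbit of [x] would be contained in [{x, f x}]. This excludes backtracking along an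
    edge. *)
Lemma no_two_cycle (T : finType) (f : T -> T) (x : T) :
  2 < #|T| -> (forall y, fconnect f x y) -> f (f x) != x.
Proof.
move=> card_T conn; apply/eqP=> ffx; suff : #|T| <= #|pred2 x (f x)|.
  by rewrite card2 => /(leq_trans card_T); case: (_ != _).
apply/subset_leq_card/subsetP=> y _; rewrite inE.
have /iter_findex <- := conn y; elim: (findex f x y) => /= [|n].
  by rewrite eqxx.
by case/pred2P=> ->; rewrite ?ffx eqxx ?orbT.
Qed.

Lemma set2_eq (T : finType) (a b c d : T) : a != b ->
  [set a; b] = [set c; d] -> a = c /\ b = d \/ a = d /\ b = c.
Proof.
move=> ab /setP eq_ab; have := eq_ab a; have := eq_ab b.
rewrite !inE !eqxx orbT /= => /esym/pred2P b_cd /esym/pred2P a_cd.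
by case: a_cd b_cd ab => -> [] ->; rewrite ?eqxx //; [left|right].
Qed.

Lemma cubic_third_neighbour (G : sgraph) (v x y : G) : cubic G ->
    adj v x -> adj v y -> x != y ->
  exists z, [/\ adj v z, z != x, z != y &
    forall w, adj v w -> [|| w == x, w == y | w == z]].
Proof.
move=> cubG vx vy xy.
have : #|[set w | adj v w] :\ x :\ y| == 1.
  have := cardsD1 y ([set w | adj v w] :\ x).
  have := cardsD1 x [set w | adj v w].
  by rewrite cubG !inE vx vy eq_sym xy !add1n => -[<-] [<-].
case/cards1P=> z /setP zP; exists z.
have := zP z; rewrite !inE eqxx => /and3P[zy zx vz]; split=> // w vw.
have := zP w; rewrite !inE vw andbT => <-.
by case: (w == x); case: (w == y).
Qed.

(** * Vertices of the truncation as darts, and the lift of an edge set *)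

Section Truncation.
Variable G : sgraph.
Local Notation T := (trunc_vertex G).
Implicit Types p q : T.

(** A vertex [v_x] is read as the dart of [G] from [v] to [x]: [base] names its triangle, and the
    reversed dart [flip p] is its partner across the connecting edge. *)
Definition base p : G := (val p).1.
Definition tip p : G := (val p).2.
Definition tvertex {v x : G} (vx : adj v x) : T := Sub (v, x) vx.

Lemma adj_base_tip p : adj (base p) (tip p). Proof. exact: valP p. Qed.

Lemma adj_tip_base p : adj (tip p) (base p).
Proof. by rewrite adj_sym adj_base_tip. Qed.

Definition flip p : T := tvertex (adj_tip_base p).

Lemma tvertex_eq p q : (p == q) = (base p == base q) && (tip p == tip q).
Proof. by []. Qed.

Lemma flipE : (forall p, base (flip p) = tip p) * (forall p, tip (flip p) = base p).
Proof. by []. Qed.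

Lemma flipK : involutive flip.
Proof. by move=> p; apply/eqP; rewrite tvertex_eq !eqxx. Qed.

Lemma base_tip_neq p : tip p != base p.
Proof. by apply: contraTneq (adj_base_tip p) => ->; rewrite adj_irrefl. Qed.

Lemma trunc_adjE p q :
  trunc_adj p q = (base p == base q) && (tip p != tip q) || (q == flip p).
Proof.
case: p q => [[v x] vx] [[w y] wy]; rewrite tvertex_eq /trunc_adj /base /tip /=.
by rewrite (eq_sym v y) (eq_sym x w) (andbC (y == v)).
Qed.

Definition edge p : {set G} := [set base p; tip p].

(* A triangle edge v_x v_y is kept unless vx and vy both lie on C, and a
   connecting edge v_x x_v is kept when vx lies on C. *)
Definition lift_rel (C : {set {set G}}) : rel T := fun p q =>
  trunc_adj p q && ((base p == base q) (+) ((edge p \in C) && (edge q \in C))).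

Definition lift_edges (C : {set {set G}}) : {set {set T}} :=
  [set [set u.1; u.2] | u in [pred u : T * T | lift_rel C u.1 u.2]].

Lemma lift_edgesP C (E : {set T}) :
  reflect (exists p q, lift_rel C p q /\ E = [set p; q]) (E \in lift_edges C).
Proof.
apply: (iffP imsetP) => [[[p q] pq ->]|[p [q [pq ->]]]]; first by exists p, q.
by exists (p, q).
Qed.

(** Let [f] act on darts. [lift_rel] is built from adjacency, bases and membership of [edge p] in
    [C], all of which this action carries along; one [g] serves every [C]. *)
Lemma truncation_automorphism (f : {perm G}) : automorphism f ->
  exists2 g : {perm truncation G}, automorphism g &
    forall C, map_edges g (lift_edges C) = lift_edges (map_edges f C).
Proof.
move=> f_aut.
have f_adj p : adj (f (base p)) (f (tip p)) by rewrite f_aut adj_base_tip.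
pose g0 p : T := tvertex (f_adj p).
have g0_inj : injective g0.
  move=> p q /eqP; rewrite tvertex_eq /= !(inj_eq perm_inj) -tvertex_eq.
  by move/eqP.
pose g : {perm truncation G} := perm g0_inj.
have bg p : base (g p) = f (base p) by rewrite permE.
have tg p : tip (g p) = f (tip p) by rewrite permE.
have g_aut p q : trunc_adj (g p) (g q) = trunc_adj p q.
  by rewrite !trunc_adjE !tvertex_eq !flipE !bg !tg !(inj_eq perm_inj).
have edge_g C p : (edge (g p) \in map_edges f C) = (edge p \in C).
  have -> : edge (g p) = f @: edge p by rewrite imsetU1 imset_set1 /edge bg tg.
  exact/mem_imset/imset_inj/perm_inj.
have lift_g C p q : lift_rel (map_edges f C) (g p) (g q) = lift_rel C p q.
  by rewrite /lift_rel g_aut !bg (inj_eq perm_inj) !edge_g.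
exists g => // C; apply/setP=> E; apply/imsetP/lift_edgesP.
  case=> _ /lift_edgesP[p [q [pq ->]]] ->; exists (g p), (g q).
  by rewrite lift_g imsetU1 imset_set1.
case=> p [q [pq ->]]; exists [set (g^-1)%g p; (g^-1)%g q].
  apply/lift_edgesP; exists ((g^-1)%g p), ((g^-1)%g q); split=> //.
  by rewrite -lift_g !permKV.
by rewrite imsetU1 imset_set1 !permKV.
Qed.

(** * Contracting a Hamiltonian cycle of the truncation *)

Section Descent.
Hypothesis cubG : cubic G.
Variable N : {perm T}.
Hypothesis card_T : 2 < #|T|.
Hypothesis adjN : forall p, trunc_adj p (N p).
Hypothesis connN : forall p q, fconnect N p q.

Lemma step_neq p : N p != p.
Proof.
by apply: contra (no_two_cycle card_T (connN p)) => /eqP Np; rewrite !Np.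
Qed.

Lemma step_out p : base (N p) != base p -> N p = flip p.
Proof.
by have := adjN p; rewrite trunc_adjE eq_sym => /orP[/andP[-> //]|/eqP->].
Qed.

(** Without an exit the orbit of [p0] would stay in the triangle of [v], yet it contains [flip p0],
    which lies in another triangle. *)
Lemma exists_exit v : exists2 p, base p = v & N p = flip p.
Proof.
have /card_gt0P[x] : 0 < #|[set x | adj v x]| by rewrite cubG.
rewrite inE => vx; pose p0 := tvertex vx.
case: (pickP [pred p | (base p == v) && (base (N p) != v)]) => [p|no_exit].
  by case/andP=> /eqP <- /step_out; exists p.
have closed n : base (iter n N p0) = v.
  elim: n => //= n IHn; have := no_exit (iter n N p0).
  by rewrite /= IHn eqxx => /negbFE/eqP.
have := iter_findex (connN p0 (flip p0)) => /(congr1 base).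
by rewrite closed => /eqP; rewrite eq_sym (negPf (base_tip_neq p0)).
Qed.

(* Predecessors of exits stay in the triangle, since N never backtracks along
   an edge; as a triangle has three vertices, the exit is unique and N runs
   z -> q -> e through it. *)
Lemma triangle_path v : exists e z q : T,
  [/\ [/\ base e = v, base z = v & base q = v],
      [/\ N z = q, N q = e, N e = flip e & N (flip z) = z] &
      forall p, base p = v -> [|| p == z, p == q | p == e]].
Proof.
have pred_base p : N p = flip p -> base ((N^-1)%g p) = base p.
  move=> Np; set r := (N^-1)%g p; have Nr : N r = p by rewrite permKV.
  apply/eqP; apply/contraT; rewrite eq_sym -{1}Nr => /step_out flip_r.
  have := no_two_cycle card_T (connN r).
  by rewrite Nr Np -Nr flip_r flipK eqxx.
have [e be Ne] := exists_exit v.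
pose q := (N^-1)%g e; have bq : base q = v by rewrite /q pred_base.
have Nq : N q = e by rewrite permKV.
have qe : q != e by rewrite -Nq eq_sym step_neq.
have tqe : tip e != tip q by rewrite tvertex_eq bq be eqxx eq_sym in qe.
have ve : adj v (tip e) by rewrite -be adj_base_tip.
have vq : adj v (tip q) by rewrite -bq adj_base_tip.
(* The darts [e] and [q] use two of the three neighbours of [v]; the third neighbour gives [z],
   which turns out to be the entry. *)
have [x [vx xe xq all_v]] := cubic_third_neighbour cubG ve vq tqe.
pose z := tvertex vx.
have in_tri p : base p = v -> [|| p == z, p == q | p == e].
  move=> bp; rewrite !tvertex_eq bp be bq !eqxx /=.
  have := all_v (tip p); rewrite -{1}bp adj_base_tip => /(_ isT).
  by rewrite [tip z]/= => /or3P[]->; rewrite ?orbT.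
have ze : z != e by rewrite tvertex_eq negb_and xe orbT.
have zq : z != q by rewrite tvertex_eq negb_and xq orbT.
(* Inside the triangle no predecessor of [z] is left: [N] has no fixed point, sends [q] to [e], and
   sends [e] outside. *)
have pred_z : base ((N^-1)%g z) != v.
  apply/eqP=> /in_tri; rewrite !(canF_eq (permKV N)) eq_sym (negPf (step_neq z)).
  rewrite Nq (negPf ze) Ne /= => /eqP /(congr1 base) /eqP.
  by rewrite flipE -[base z]be eq_sym (negPf (base_tip_neq e)).
(* If [N] left the triangle at [z], then [pred_base] would put the predecessor of [z] inside it. *)
have bNz : base (N z) = v.
  apply/eqP; apply/contraT=> /step_out /pred_base bz.
  by rewrite bz eqxx in pred_z.
exists e, z, q; split=> //; split=> //.
  have := in_tri _ bNz; rewrite (negPf (step_neq z)) -Nq (inj_eq perm_inj).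
  by rewrite (negPf zq) orbF => /eqP.
have := @step_out ((N^-1)%g z); rewrite permKV eq_sym => /(_ pred_z) {1}->.
by rewrite flipK permKV.
Qed.

(** At each [v] the entry [z] and the exit [e] lie over edges of [C] and the middle dart [q] does
    not ([edgeC]). So the lift keeps [zq] and [qe], drops [ze], and keeps the connecting edges at
    [z] and [e]: exactly the edges used by [N]. *)
Lemma hamiltonian_descent :
  exists2 C, hamiltonian_cycle C & [set [set p; N p] | p : T] = lift_edges C.
Proof.
have [e /fin_all_exists[z /fin_all_exists[q tri]]] := fin_all_exists triangle_path.
have be v : base (e v) = v by have [[]] := tri v.
have bz v : base (z v) = v by have [[]] := tri v.
have bq v : base (q v) = v by have [[]] := tri v.
have Nz v : N (z v) = q v by have [_ []] := tri v.
have Nq v : N (q v) = e v by have [_ []] := tri v.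
have Ne v : N (e v) = flip (e v) by have [_ []] := tri v.
have Nfz v : N (flip (z v)) = z v by have [_ []] := tri v.
have triP p : [\/ p = z (base p), p = q (base p) | p = e (base p)].
  by have [_ _ /(_ p erefl)/or3P[]/eqP] := tri (base p);
    [constructor 1|constructor 2|constructor 3].
(* The contracted successor of [v] is the triangle to which its exit leads. *)
pose s v := tip (e v).
have baseN p : base (N p) = if p == e (base p) then s (base p) else base p.
  have zNe v : z v != e v by rewrite -Nq -Nz eq_sym no_two_cycle.
  have qNe v : q v != e v by rewrite -Nq eq_sym step_neq.
  case: (triP p) => ->; rewrite ?bz ?bq ?be ?eqxx.
  - by rewrite (negPf (zNe _)) Nz bq.
  - by rewrite (negPf (qNe _)) Nq be.
  by rewrite Ne.
have exit_flip p : N p = flip p -> p = e (base p).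
  move=> Np; apply/eqP/negPn/negP=> pe; have := baseN p.
  by rewrite (negPf pe) Np => /eqP; rewrite (negPf (base_tip_neq p)).
pose C := [set [set v; s v] | v : G].
have edgeC p : (edge p \in C) = (p != q (base p)).
  case: (triP p); move: (base p) => v ->; rewrite ?bz ?bq ?be.
  (* Since [N] enters at [z] from [flip z], the dart [flip z] is the exit of the neighbouring
     triangle. *)
  - rewrite -Nz eq_sym step_neq; apply/imsetP; exists (tip (z v)) => //.
    have /exit_flip : N (flip (z v)) = flip (flip (z v)) by rewrite Nfz flipK.
    by move/(congr1 tip); rewrite !flipE /edge setUC /s => <-.
  (* If [edge q] were in [C], either [q] would be the exit of [v], or [N] would reach [q] from the
     exit of another triangle, whereas it reaches [q] from [z]. *)
  - rewrite eqxx; apply/negP=> /imsetP[u _ /set2_eq].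
    rewrite eq_sym base_tip_neq bq => /(_ isT)[] [Ev Et].
      have := step_neq (q v).
      by rewrite Nq tvertex_eq be bq Et Ev !eqxx.
    have : N (e u) = N (z v).
      rewrite Nz Ne; apply/eqP; rewrite tvertex_eq !flipE bq be Et.
      by rewrite -[tip (e u)]Ev !eqxx.
    move/perm_inj/(congr1 base); rewrite be bz -Et => /eqP.
    by rewrite -[X in _ == X]bq (negPf (base_tip_neq _)).
  rewrite -Nq step_neq Nq; apply/imsetP; exists v => //.
  by rewrite /edge be.
exists C.
  apply: hamiltonian_cycle_fun => [|v|v w].
  - have [p _] : exists p : T, p \in T by apply/card_gt0P; apply: leq_trans card_T.
    by rewrite -(cubG (base p)) max_card.
  - by rewrite -{1}(be v) adj_base_tip.
  (* Project the [N]-path from [e v] to [e w]: by [baseN] each step fixes the base or applies [s] to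
     it. *)
  have /iter_findex := connN (e v) (e w).
  move/(congr1 base); rewrite be => <-; elim: (findex _ _ _) => /= [|n IHn].
    by rewrite be.
  rewrite baseN; case: ifP => // _.
  exact: connect_trans IHn (fconnect1 _ _).
apply/setP=> E; apply/imsetP/lift_edgesP.
  case=> p _ ->; exists p, (N p); split=> //.
  rewrite /lift_rel adjN !edgeC.
  case: (triP p); move: (base p) => v ->; rewrite ?Nz ?Nq ?bz ?bq ?be ?eqxx ?andbF //.
  (* For an exit, the target [N (e v)] must not be a middle dart: [q (s v)] is reached from
     [z (s v)], whose base is [s v] and not [v]. *)
  have sv : (s v == v) = false by rewrite -[X in _ == X]be (negPf (base_tip_neq _)).
  rewrite baseN be eqxx eq_sym sv -Nq step_neq Nq -Nz (inj_eq perm_inj).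
  by apply/eqP => /(congr1 base) /esym /eqP; rewrite be bz sv.
case=> p [p' [+ ->]]; rewrite /lift_rel !edgeC => /andP[].
(* A kept triangle edge has an end whose edge is not in [C], hence a middle dart; as the edge is
   unordered, that end may be called [p]. *)
wlog pq : p p' / (base p == base p') ==> (p == q (base p)) => [hwlog|].
  have [pq|] := boolP ((base p == base p') ==> (p == q (base p))).
    exact: hwlog pq.
  rewrite negb_imply => /andP[/eqP eq_base npq].
  rewrite eq_base eqxx -{1}eq_base npq /= negbK trunc_adj_sym setUC => pp' p'q.
  by apply: hwlog; rewrite -?eq_base ?eqxx // eq_base p'q.
rewrite trunc_adjE; have [eq_base|neq_base] /= := eqVneq (base p) (base p').
  move: pq; rewrite eq_base eqxx /=; case: (triP p').
  - move=> p'z /eqP -> _; exists (z (base p')) => //.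
    by rewrite Nz {2}p'z setUC.
  - move=> p'q /eqP ->; rewrite -p'q eqxx tvertex_eq flipE eq_sym.
    by rewrite (negPf (base_tip_neq _)).
  move=> p'e /eqP -> _; exists (q (base p')) => //.
  by rewrite Nq {2}p'e.
(* A kept connecting edge has [p] as entry or exit, so [N] traverses it from [flip p] to [p] or from
   [p] to [flip p]. *)
move=> /eqP -> /andP[+ _].
case: (triP p) => ->; rewrite ?bz ?bq ?be ?eqxx // => _.
  by exists (flip (z (base p))); rewrite // Nfz setUC.
by exists (e (base p)); rewrite // Ne.
Qed.

End Descent.

(** * Lifting a Hamiltonian cycle to the truncation *)

Lemma hamiltonian_ascent (s : {perm G}) : cubic G ->
    2 < #|G| -> (forall v, adj v (s v)) -> (forall v w, fconnect s v w) ->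
  exists C : {set {set truncation G}}, hamiltonian_cycle C.
Proof.
move=> cubG card_G adj_s conn_s.
have adj_s' v : adj v ((s^-1)%g v) by rewrite adj_sym -{2}(permKV s v).
have s's v : s v != (s^-1)%g v.
  rewrite -(inj_eq (@perm_inj _ s)) permKV.
  exact: no_two_cycle.
have [m m_third] := fin_all_exists (fun v =>
  cubic_third_neighbour cubG (adj_s v) (adj_s' v) (s's v)).
have adj_m v : adj v (m v) by have [] := m_third v.
(* [P v] points to the predecessor of [v] on the cycle, [E v] to its successor and [M v] to the
   third neighbour. The lifted cycle runs [P v], [M v], [E v] and crosses to [P (s v)]. *)
pose P v := tvertex (adj_s' v); pose M v := tvertex (adj_m v).
pose E v := tvertex (adj_s v).
have triP p : [\/ p = P (base p), p = M (base p) | p = E (base p)].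
  have [_ _ _ /(_ _ (adj_base_tip p))] := m_third (base p).
  by case/or3P=> /eqP tp; [constructor 3|constructor 1|constructor 2];
    apply/eqP; rewrite tvertex_eq tp !eqxx.
pose N p := if p == P (base p) then M (base p)
  else if p == M (base p) then E (base p) else flip p.
have NP v : N (P v) = M v by rewrite /N eqxx.
have NM v : N (M v) = E v.
  have [_ _ ms' _] := m_third v.
  by rewrite /N eqxx tvertex_eq (negPf ms') andbF.
have flipEP v : flip (E v) = P (s v).
  by apply/eqP; rewrite tvertex_eq !flipE /tip /= permK !eqxx.
have NE v : N (E v) = P (s v).
  have [_ ms _ _] := m_third v.
  rewrite /N !tvertex_eq (negPf (s's v)) (eq_sym _ (tip (M _))) (negPf ms) !andbF.
  exact: flipEP.
have PtoM v : fconnect N (P v) (M v) by rewrite -NP fconnect1.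
have PtoE v : fconnect N (P v) (E v).
  by apply: connect_trans (PtoM v) _; rewrite -NM fconnect1.
have EtoP v : fconnect N (E v) (P (s v)) by rewrite -NE fconnect1.
have PtoP v w : fconnect N (P v) (P w).
  have /iter_findex <- := conn_s v w.
  elim: (findex _ _ _) => //= n IHn.
  exact: connect_trans IHn (connect_trans (PtoE _) (EtoP _)).
(* Any two darts are joined through entries: each dart reaches the next entry, entries reach each
   other along [s], and an entry reaches its whole triangle. *)
have toP p : fconnect N p (P (s (base p))).
  case: (triP p) => -> //; apply: connect_trans (EtoP (base p)).
  by rewrite -NM fconnect1.
have fromP p : fconnect N (P (base p)) p by case: (triP p) => {2}->.
eexists; apply: (@hamiltonian_cycle_fun (truncation G) N).
- apply: leq_trans card_G _; apply: (@leq_card _ _ P).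
  by move=> v w /(congr1 base).
- move=> p; rewrite [adj p _]trunc_adjE.
  have [_ ms ms' _] := m_third (base p).
  move: ms ms'; case: (triP p); move: (base p) => v -> ms ms'.
  - by rewrite NP eqxx [tip (P v) == _]eq_sym ms'.
  - by rewrite NM eqxx ms.
  by rewrite NE flipEP eqxx orbT.
- move=> p p'; apply: connect_trans (toP p) _.
  exact: connect_trans (PtoP _ _) (fromP p').
Qed.

End Truncation.

(** * Transfer of Hamiltonian-transitivity to the truncation *)

Theorem lemma35 (G : sgraph) (Gcubic : cubic G)
    (Gtrans : hamiltonian_transitive G) :
  hamiltonian_transitive (truncation G).
Proof.
have [[C0 /hamiltonian_cycle_perm[s [card_G adj_s conn_s _]]] trans] := Gtrans.
have descend D : @hamiltonian_cycle (truncation G) D ->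
    exists2 C, hamiltonian_cycle C & D = lift_edges C.
  case/hamiltonian_cycle_perm=> N [card_T adjN connN ->].
  exact: hamiltonian_descent.
split; first exact: hamiltonian_ascent card_G adj_s conn_s.
move=> _ _ /descend[C hamC ->] /descend[D hamD ->].
have [f f_aut <-] := trans C D hamC hamD.
by have [g g_aut lift_g] := truncation_automorphism f_aut; exists g.
Qed.
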